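(* Let $n\ge 1$ and let $\lambda_0,\ldots,\lambda_{n-1}\in\mathbb{R}$. The matrix $P^\lambda$ is the transition matrix of an involutive walk on $\{0,\ldots,n-1\}$ if and only if $\lambda_0=1$ and $$\sum_{e=0}^{z}(-1)^e\binom{z}{e}\lambda_{n-1-z+e}\ge 0$$ for all $z\in\{0,\ldots,n-1\}$. Moreover, if (in addition to $\lambda_0=1$) strict inequality holds for all $z\in\{0,\ldots,n-1\}$, then $1>\lambda_1>\cdots>\lambda_{n-1}$, and for $x,z\in\{0,\ldots,n-1\}$ we have $P^\lambda_{xz}>0$ if and only if $x+z\ge n-1$.
   Context: Rows and columns of matrices are numbered from $0$. Let $B(n)$ be the $n\times n$ matrix with $B(n)_{xy}=\binom{x}{y}$, and $J(n)$ the $n\times n$ matrix with $J(n)_{xy}=1$ if $x+y=n-1$ and $0$ otherwise. Define $H^\lambda=B(n)\,\mathrm{Diag}(\lambda_0,\ldots,\lambda_{n-1})\,B(n)^{-1}$ and $P^\lambda=H^\lambda J(n)$. An involutive walk on $\{0,\ldots,n-1\}$ is a Markov chain in which from state $x$ one chooses $y\in\{0,\ldots,x\}$ according to some probability distribution depending on $x$ and then steps to $n-1-y$. Equivalently, its transition matrix $P$ is a stochastic matrix with $P_{xz}=0$ whenever $x+z<n-1$. *)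

(* Defs.v *)
From mathcomp Require Import all_boot all_order all_algebra.
From mathcomp Require Import reals zify.

Set Implicit Arguments.
Unset Strict Implicit.
Unset Printing Implicit Defensive.

Import Order.TTheory GRing.Theory Num.Theory.

Local Open Scope ring_scope.

Definition pascal_mx (R : realType) (n : nat) : 'M[R]_n :=
  \matrix_(x < n, y < n) 'C(x, y)%:R.

Definition antidiag_mx (R : realType) (n : nat) : 'M[R]_n :=
  \matrix_(x < n, y < n) ((x + y)%N == n.-1)%:R.

Definition H_mx (R : realType) (n : nat) (lam : n.-tuple R) : 'M[R]_n :=
  pascal_mx R n *m diag_mx (\row_(i < n) tnth lam i) *m invmx (pascal_mx R n).

Definition P_mx (R : realType) (n : nat) (lam : n.-tuple R) : 'M[R]_n :=
  H_mx lam *m antidiag_mx R n.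

Definition is_distr (R : realType) (n : nat) (p : 'I_n -> R) : Prop :=
  (forall y, 0 <= p y) /\ \sum_(y < n) p y = 1.

Definition stochastic_mx (R : realType) (n : nat) (P : 'M[R]_n) : Prop :=
  forall x, is_distr (P x).

(* [q x] is the distribution of the intermediate state chosen from [x]; the
   involution y |-> n - 1 - y on 'I_n is [rev_ord]. *)
Definition involutive_walk_mx (R : realType) (n : nat) (P : 'M[R]_n) : Prop :=
  exists q : 'I_n -> 'I_n -> R,
    [/\ forall x, is_distr (q x),
        forall x y : 'I_n, (x < y)%N -> q x y = 0
      & forall x z : 'I_n, P x z = \sum_(y < n | rev_ord y == z) q x y].

(* [invmx] is a genuine inverse in [H_mx]. *)
Lemma pascal_mx_unit (R : realType) (n : nat) : pascal_mx R n \in unitmx.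
Proof.
rewrite unitmxE det_trig; last first.
  by apply/is_trig_mxP => x y xy; rewrite mxE bin_small.
by rewrite big1 ?unitr1 // => i _; rewrite mxE binn.
Qed.

Lemma involutive_walk_mxP (R : realType) (n : nat) (P : 'M[R]_n) :
  involutive_walk_mx P <->
  stochastic_mx P /\ forall x z : 'I_n, (x + z < n.-1)%N -> P x z = 0.
Proof.
have revE (z : 'I_n) (f : 'I_n -> R) :
    \sum_(y < n | rev_ord y == z) f y = f (rev_ord z).
  rewrite (big_pred1 (rev_ord z)) // => y.
  by rewrite -(inj_eq rev_ord_inj) rev_ordK.
have sumE (f : 'I_n -> R) : \sum_(y < n) f (rev_ord y) = \sum_(y < n) f y.
  by rewrite [RHS](reindex_inj rev_ord_inj).
split=> [[q [qd q0 Pq]] | [Pd P0]].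
  have {}Pq x z : P x z = q x (rev_ord z) by rewrite Pq revE.
  split=> [x | x z xz].
    split=> [z|]; first by rewrite Pq; exact: (qd x).1.
    under eq_bigr do rewrite Pq.
    by rewrite sumE; exact: (qd x).2.
  rewrite Pq q0 //=.
  by have := ltn_ord z; lia.
exists (fun x y => P x (rev_ord y)); split=> [x | x y xy | x z].
- split=> [y|]; first exact: (Pd x).1.
  by rewrite sumE; exact: (Pd x).2.
- by apply: P0 => /=; have := ltn_ord y; lia.
- by rewrite revE rev_ordK.
Qed.

(* Main.v *)
(** Let [D m y = \sum_e (-1)^e 'C(m, e) lam_(y + e)]. Since ['C(x, k) 'C(k, y) =
    'C(x, y) 'C(x - y, k - y)], the entries of [H] are [H x y = 'C(x, y) D (x - y) y],
    and [P] is [H] with its columns reversed. The hypotheses bound [D] on the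
    antidiagonal [m + y = n - 1]; the recurrence [D m y = D m.+1 y + D m y.+1]
    spreads their sign to the whole triangle [m + y < n]. Each row of [H] sums
    to [lam_0], and [lam_k - lam_(k+1) = D 1 k]. *)
Require Import Defs.
From mathcomp Require Import all_boot all_order all_algebra.
From mathcomp Require Import reals.
From mathcomp Require Import zify ring.
Import Order.TTheory GRing.Theory Num.Theory.
Local Open Scope ring_scope.

(** Multiplied by [(x - k)! (k - y)! y!], both sides become [x!] when [k <= x]. When [x < k], both
    sides vanish. *)
Lemma mul_bin_bin (x k y : nat) :
  (y <= k -> 'C(x, k) * 'C(k, y) = 'C(x, y) * 'C(x - y, k - y))%N.
Proof.
move=> yk; have [xk|kx] := ltnP x k.
  rewrite (bin_small xk) mul0n; have [xy|yx] := ltnP x y.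
    by rewrite (bin_small xy).
  by rewrite (@bin_small (x - y)) ?muln0 //; lia.
have f_gt0 : (0 < (x - k)`! * (k - y)`! * y`!)%N by rewrite !muln_gt0 !fact_gt0.
apply/eqP; rewrite -(eqn_pmul2r f_gt0); apply/eqP.
have h1 := bin_fact kx; have h2 := bin_fact yk.
have h3 := bin_fact (leq_trans yk kx).
have /bin_fact : (k - y <= x - y)%N by lia.
rewrite (_ : (x - y - (k - y) = x - k)%N); last by lia.
move=> h4; transitivity x`!.
  by rewrite -h1 -h2; ring.
by rewrite -h3 -h4; ring.
Qed.

(** The [D] of the overview for a general sequence: [(-1)^m] times the [m]-th forward difference of
    [f] at [y]. *)
Definition alt_diff {R : comNzRingType} (f : nat -> R) (m y : nat) : R :=
  \sum_(0 <= e < m.+1) (-1) ^+ e * 'C(m, e)%:R * f (y + e)%N.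

Lemma alt_diff0 {R : comNzRingType} (f : nat -> R) y : alt_diff f 0 y = f y.
Proof. by rewrite /alt_diff big_nat1 mul1r mul1r addn0. Qed.

(** Pascal's rule splits each coefficient in two; the extra top term contains ['C(m, m.+1) = 0]. *)
Lemma alt_diffS {R : comNzRingType} (f : nat -> R) m y :
  alt_diff f m.+1 y = alt_diff f m y - alt_diff f m y.+1.
Proof.
rewrite /alt_diff big_nat_recl // [in RHS]big_nat_recl //.
under eq_bigr do rewrite binS natrD mulrDr mulrDl.
rewrite big_split /= [X in _ + (X + _)]big_nat_recr //= (bin_small (ltnSn m)).
rewrite mulr0 mul0r addr0 !bin0 addrA; congr (_ + _).
rewrite -sumrN; apply: eq_bigr => i _.
by rewrite exprS addSnnS; ring.
Qed.

Lemma alt_diff1 {R : comNzRingType} (m : nat) :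
  alt_diff (fun=> 1 : R) m 0 = (m == 0%N)%:R.
Proof.
have diff_y k y : alt_diff (fun=> 1 : R) k y = alt_diff (fun=> 1) k 0 by [].
by case: m => [|m]; rewrite ?alt_diff0 // alt_diffS !diff_y subrr.
Qed.

(** The left side is an entry of [B Diag(f)] times the signed Pascal matrix. Only [y <= k <= x]
    contributes; with [k = e + y] the sign reduces to [(-1)^e]. *)
Lemma sum_bin_alt_diff {R : comNzRingType} (f : nat -> R) (n x y : nat) :
  (x < n)%N ->
  \sum_(k < n) 'C(x, k)%:R * f k * ((-1) ^+ (k + y) * 'C(k, y)%:R) =
  'C(x, y)%:R * alt_diff f (x - y) y.
Proof.
move=> xn; have [xy|yx] := ltnP x y.
  rewrite [in RHS]bin_small // mul0r big1 // => k _.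
  have [xk|kx] := ltnP x k; first by rewrite (@bin_small x) // !mul0r.
  by rewrite (@bin_small k) ?mulr0 //; lia.
rewrite -(big_mkord xpredT (fun k =>
  'C(x, k)%:R * f k * ((-1) ^+ (k + y) * 'C(k, y)%:R))).
rewrite (big_cat_nat _ (n := y)) //=; last by lia.
rewrite big_nat_cond big1 ?add0r; last first.
  by move=> k /andP[/andP[_ ky] _]; rewrite (@bin_small k) ?mulr0.
rewrite (big_cat_nat _ (n := x.+1)) //=; last by lia.
rewrite [X in _ + X]big_nat_cond [X in _ + X]big1 ?addr0; last first.
  by move=> k /andP[/andP[xk _] _]; rewrite bin_small ?mul0r.
rewrite -{1}[y]add0n big_addn (_ : x.+1 - y = (x - y).+1)%N; last by lia.
rewrite mulr_sumr; apply: eq_bigr => e _.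
have := congr1 (fun i => i%:R : R) (mul_bin_bin x _ _ (leq_addl e y)).
rewrite addnK !natrM -addnA exprD addnn -mul2n exprM sqrrN !expr1n => hC.
rewrite mulr1 [(y + e)%N]addnC.
transitivity ((-1) ^+ e * f (e + y)%N * ('C(x, e + y)%:R * 'C(e + y, y)%:R) : R).
  by ring.
by rewrite hC; ring.
Qed.

(** The previous sum with [f = 1] gives the entries of the product with [B]: differences of a
    constant vanish off the diagonal. *)
Lemma invmx_pascal (R : realType) (n : nat) :
  invmx (pascal_mx R n) =
  \matrix_(x < n, y < n) ((-1) ^+ (x + y) * 'C(x, y)%:R).
Proof.
set Bi := RHS; suff BBi : pascal_mx R n *m Bi = 1%:M.
  by rewrite -[LHS]mulmx1 -BBi mulmxA mulVmx ?mul1mx // pascal_mx_unit.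
apply/matrixP => x y; rewrite !mxE.
under eq_bigr do rewrite !mxE -['C(x, _)%:R]mulr1.
rewrite (sum_bin_alt_diff (fun=> 1)) // [alt_diff _ _ _]alt_diff1 -val_eqE /=.
case: (ltngtP x y) => [xy|yx|->].
- by rewrite bin_small // mul0r.
- by rewrite (_ : (x - y == 0)%N = false) ?mulr0 //; lia.
- by rewrite subnn binn mulr1.
Qed.

Lemma H_mxE (R : realType) (n : nat) (lam : n.-tuple R) (x y : 'I_n) :
  H_mx lam x y = 'C(x, y)%:R * alt_diff (nth 0 lam) (x - y) y.
Proof.
rewrite -(@sum_bin_alt_diff _ _ n) // /H_mx invmx_pascal mxE.
apply: eq_bigr => k _; rewrite mul_mx_diag !mxE.
by rewrite (tnth_nth 0).
Qed.

Lemma P_mxE (R : realType) (n : nat) (lam : n.-tuple R) (x z : 'I_n) :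
  P_mx lam x z = H_mx lam x (rev_ord z).
Proof.
rewrite mxE (bigD1 (rev_ord z)) //= big1 => [|y yz]; rewrite !mxE /=.
  by rewrite (_ : _ == _) ?mulr1 ?addr0 //; have := ltn_ord z; lia.
rewrite (_ : (_ == _) = false) ?mulr0 //.
by apply: contraNF yz; rewrite -val_eqE /=; have := ltn_ord z; lia.
Qed.

Lemma P_mx_diffE (R : realType) (n : nat) (lam : n.-tuple R) (x z : 'I_n) :
  P_mx lam x z = 'C(x, n - 1 - z)%:R *
    alt_diff (nth 0 lam) (x - (n - 1 - z)) (n - 1 - z).
Proof. by rewrite P_mxE H_mxE /= -subnDA add1n. Qed.

(** Column 0 of [B] is the all-ones vector, so that vector is an eigenvector of [H] with eigenvalue
    [lam_0]; reversing columns preserves row sums. *)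
Lemma sum_P_mx (R : realType) (n : nat) (lam : n.-tuple R) (x : 'I_n) :
  \sum_(z < n) P_mx lam x z = lam`_0.
Proof.
under eq_bigr do rewrite P_mxE.
transitivity (\sum_(y < n) H_mx lam x y).
  by rewrite [RHS](reindex_inj rev_ord_inj).
have n_gt0 : (0 < n)%N by apply: leq_ltn_trans (ltn_ord x).
pose e0 : 'cV[R]_n := delta_mx (Ordinal n_gt0) 0.
have mul_e0 (A : 'M[R]_n) y i : (A *m e0) y i = A y (Ordinal n_gt0).
  by rewrite -colE mxE.
have B_e0 : pascal_mx R n *m e0 = const_mx 1.
  by apply/matrixP => y i; rewrite mul_e0 !mxE bin0.
transitivity ((H_mx lam *m const_mx 1 : 'cV[R]_n) x 0).
  by rewrite mxE; apply: eq_bigr => y _; rewrite [const_mx 1 _ _]mxE mulr1.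
rewrite -B_e0 /H_mx mulmxA mulmxKV ?pascal_mx_unit //.
by rewrite mul_e0 mul_mx_diag !mxE bin0 mul1r (tnth_nth 0).
Qed.

(** Induction on the distance [d = N - (m + y)] to the antidiagonal: both terms of the recurrence
    lie one step closer to it. *)
Lemma alt_diff_ge0 {R : numDomainType} (f : nat -> R) (N : nat) :
  (forall z, (z <= N)%N -> 0 <= alt_diff f z (N - z)) ->
  forall m y, (m + y <= N)%N -> 0 <= alt_diff f m y.
Proof.
move=> f_ge0 m y /subnK; move: (N - _)%N => d.
elim: d m y => [|d IHd] m y dmy.
  by rewrite (_ : y = N - m)%N ?f_ge0 //; lia.
rewrite -[alt_diff f m y](subrK (alt_diff f m y.+1)) -alt_diffS.
by rewrite addr_ge0 // IHd //; lia.
Qed.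

Lemma alt_diff_gt0 {R : numDomainType} (f : nat -> R) (N : nat) :
  (forall z, (z <= N)%N -> 0 < alt_diff f z (N - z)) ->
  forall m y, (m + y <= N)%N -> 0 < alt_diff f m y.
Proof.
move=> f_gt0 m y /subnK; move: (N - _)%N => d.
elim: d m y => [|d IHd] m y dmy.
  by rewrite (_ : y = N - m)%N ?f_gt0 //; lia.
rewrite -[alt_diff f m y](subrK (alt_diff f m y.+1)) -alt_diffS.
by rewrite addr_gt0 // IHd //; lia.
Qed.

Theorem corollary1p6 (R : realType) (n : nat) (hn : (0 < n)%N)
    (lam : n.-tuple R) :
  (involutive_walk_mx (P_mx lam) <->
     lam`_0 = 1 /\
     forall z : 'I_n,
       0 <= \sum_(0 <= e < z.+1)
              (-1) ^+ e * 'C(z, e)%:R * lam`_(n - 1 - z + e)) /\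
  (lam`_0 = 1 ->
   (forall z : 'I_n,
      0 < \sum_(0 <= e < z.+1)
             (-1) ^+ e * 'C(z, e)%:R * lam`_(n - 1 - z + e)) ->
   path >%R 1 (behead lam) /\
   forall x z : 'I_n, (0 < P_mx lam x z) <-> (n - 1 <= x + z)%N).
Proof.
have P0 (x z : 'I_n) : (x + z < n - 1)%N -> P_mx lam x z = 0.
  by move=> xz; rewrite P_mx_diffE bin_small ?mul0r //; lia.
split; first split.
- move=> /involutive_walk_mxP[Pd _]; split.
    by rewrite -(sum_P_mx _ _ lam (Ordinal hn)); exact: (Pd _).2.
  (* In the last row, [x = n - 1], the entry at [z] is the sum in question times the positive factor
     ['C(n - 1, n - 1 - z)]. *)
  move=> z; have last_lt : (n - 1 < n)%N by lia.
  have := (Pd (Ordinal last_lt)).1 z; rewrite P_mx_diffE /= subKn; last first.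
    by have := ltn_ord z; lia.
  by rewrite pmulr_rge0 // ltr0n bin_gt0; lia.
- move=> [lam0 lam_ge0]; apply/involutive_walk_mxP; split; last first.
    by move=> x z xz; apply: P0; lia.
  move=> x; split=> [z|]; last by rewrite sum_P_mx.
  have [xz|xz] := ltnP (x + z)%N (n - 1)%N; first by rewrite P0.
  rewrite P_mx_diffE mulr_ge0 ?ler0n // (@alt_diff_ge0 _ _ (n - 1)) //.
    by move=> m mn; have mn' : (m < n)%N by [lia]; exact: lam_ge0 (Ordinal mn').
  by have := ltn_ord x; lia.
move=> lam0 lam_gt0.
have D_gt0 : forall m y, (m + y <= n - 1)%N -> 0 < alt_diff (nth 0 lam) m y.
  apply: alt_diff_gt0 => m mn; have mn' : (m < n)%N by lia.
  exact: lam_gt0 (Ordinal mn').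
split.
  have size_bh : size (behead lam) = n.-1 by rewrite size_behead size_tuple.
  (* With [lam_0 = 1] as the head, the path condition compares consecutive entries of [lam]. *)
  have lamE : lam = 1 :: behead lam :> seq R.
    by rewrite -lam0; case: (lam : seq R) (size_tuple lam) hn => [<-|].
  apply/(pathP 0) => i; rewrite size_bh => i_lt.
  have /(D_gt0 1%N i) : (1 + i <= n - 1)%N by lia.
  by rewrite alt_diffS !alt_diff0 subr_gt0 nth_behead -lamE.
move=> x z; split=> [|xz].
  by apply: contraTT; rewrite -ltnNge => xz; rewrite P0 ?ltxx.
(* Here [n - 1 - z <= x], so the binomial is positive and the two arguments of [alt_diff] add up to
   [x <= n - 1]. *)
rewrite P_mx_diffE mulr_gt0 ?ltr0n ?bin_gt0 ?D_gt0 //; first by lia.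
by have := ltn_ord x; lia.
Qed.
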